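(* Let $d$ be a positive integer. Then there exists an atomic Puiseux monoid $M$ such that $\Delta(M) = \{md \mid m \in \mathbb{N}\}$.
   Context: $\mathbb{N}$ is the set of positive integers. A Puiseux monoid is an additive submonoid of $\mathbb{Q}_{\geq 0}$. An atom of such a monoid $M$ is a nonzero element that is not a sum of two nonzero elements of $M$; $M$ is atomic if it is generated (as a monoid) by its set of atoms $\mathcal{A}(M)$. A factorization of $x \in M$ is a formal sum (element of the free commutative monoid on $\mathcal{A}(M)$) $a_1 + \cdots + a_k$ of atoms whose sum in $M$ is $x$; its length is $k$. $\mathsf{L}(x)$ is the set of lengths of all factorizations of $x$. For nonzero $x \in M$, $\Delta(x)$ is the set of positive integers $\delta$ such that $\mathsf{L}(x) \cap [l, l+\delta] = \{l, l+\delta\}$ for some $l \in \mathsf{L}(x)$, and the set of distances of $M$ is $\Delta(M) := \bigcup_{0 \neq x \in M} \Delta(x)$. *)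

(* Defs.v *)
From HB Require Import structures.
From mathcomp Require Import all_boot all_order all_algebra.
From mathcomp Require Import finmap multiset.
From mathcomp Require Import classical_sets.

Set Implicit Arguments.
Unset Strict Implicit.
Unset Printing Implicit Defensive.

Import Order.TTheory GRing.Theory Num.Theory.

Local Open Scope mset_scope.
Local Open Scope classical_set_scope.
Local Open Scope ring_scope.

(* Sets of rationals are classical (Prop-valued), so ssralg's addr_closed,
   which is about boolean predicates, does not apply. *)
Definition is_submonoid (M : set rat) : Prop :=
  M 0 /\ (forall x y : rat, M x -> M y -> M (x + y)).

Definition puiseux_monoid (M : set rat) : Prop :=
  is_submonoid M /\ M `<=` [set x | 0 <= x].

Definition atoms (M : set rat) : set rat :=
  [set a | [/\ M a, a <> 0 &
    ~ exists x y : rat, [/\ M x, M y, x <> 0, y <> 0 & a = x + y]]].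

Definition atomic (M : set rat) : Prop :=
  smallest is_submonoid (atoms M) = M.

(* A formal sum of atoms is a finite multiset of atoms; its elements are listed
   with multiplicity by the coercion of {mset rat} to seq rat. *)
Definition factorizations (M : set rat) (x : rat) : set {mset rat} :=
  [set z : {mset rat} | (forall a : rat, a \in z -> atoms M a) /\
    \sum_(a <- z) a = x].

Definition lengths (M : set rat) (x : rat) : set nat :=
  [set size z | z in factorizations M x].

Definition distances (M : set rat) (x : rat) : set nat :=
  [set delta : nat | (0 < delta)%N /\
    exists2 l : nat, lengths M x l &
      lengths M x `&` [set n : nat | (l <= n <= l + delta)%N]
        = [set l; (l + delta)%N]].

Definition set_of_distances (M : set rat) : set nat :=
  \bigcup_(x in M `\ (0 : rat)) distances M x.

(* Main.v *)
(** Write e = (m+1)d. The monoid is generated by the fractions (e+1)/p_m and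
    (2e+1)/p_m for m = 0, 1, 2, ..., where the p_m are pairwise coprime,
    congruent to 1 modulo d, and p_m > (e+1)(2e+1).

    Every generator is congruent to 1 modulo d in the localization of the
    integers at the numbers coprime to d, so the length of any factorization of
    x is congruent to x; hence all distances are multiples of d.

    An element c/p_m < 1 involves only the two generators of denominator p_m:
    by coprimality, the generators of denominator p_j (j <> m) would contribute
    an integer. Hence all generators are atoms, and since e+1 and 2e+1 are
    coprime, (e+1)(2e+1)/p_m has exactly the lengths e+1 and 2e+1, which
    realizes the distance e. *)
Require Import Defs.
From mathcomp Require Import all_boot all_order all_algebra.
From mathcomp Require Import finmap multiset.
From mathcomp Require Import classical_sets.
From mathcomp Require Import zify ring lra.

Set Implicit Arguments.
Unset Strict Implicit.

Import Order.TTheory GRing.Theory Num.Theory.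

Local Open Scope classical_set_scope.
Local Open Scope ring_scope.

(** * Rationals with a denominator coprime to [p], where [p] may be composite *)

Definition locally_integral (p : nat) (x : rat) : Prop :=
  exists2 v : nat, coprime v p & v%:R * x \is a Num.int.

Lemma locally_integral_int p x : x \is a Num.int -> locally_integral p x.
Proof. by move=> xZ; exists 1; rewrite ?coprime1n ?mul1r. Qed.

Lemma locally_integralD p x y :
  locally_integral p x -> locally_integral p y -> locally_integral p (x + y).
Proof.
move=> [v cv vx] [w cw wy]; exists (v * w)%N; first by rewrite coprimeMl cv.
have -> : (v * w)%:R * (x + y) = w%:R * (v%:R * x) + v%:R * (w%:R * y).
  by rewrite natrM; ring.
by rewrite rpredD // rpredM // ?rpred_nat.
Qed.

Lemma locally_integralB p x y :
  locally_integral p x -> locally_integral p y -> locally_integral p (x - y).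
Proof.
move=> px [v cv vy]; apply: locally_integralD => //.
by exists v; rewrite // mulrN rpredN.
Qed.

Lemma locally_integral_div p q n :
  coprime q p -> (0 < q)%N -> locally_integral p (n%:R / q%:R).
Proof.
move=> cqp q0; exists q => //.
by rewrite mulrC divfK ?rpred_nat // pnatr_eq0 -lt0n.
Qed.

(** Clearing denominators gives [p %| v * n] with [v] coprime to [p], so Gauss's lemma applies. *)
Lemma locally_integral_dvd p n :
  (0 < p)%N -> locally_integral p (n%:R / p%:R) -> (p %| n)%N.
Proof.
move=> p0 [v cvp /intrP[u uE]].
have : (v * n)%:Z = u * p%:Z.
  apply: (@intr_inj rat); rewrite intrM -uE -!pmulrn natrM -mulrA divfK //.
  by rewrite pnatr_eq0 -lt0n.
move=> vnE; have : (p%:Z %| (v * n)%:Z)%Z by rewrite vnE dvdz_mull.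
by rewrite dvdzE !absz_nat Gauss_dvdr // coprime_sym.
Qed.

Lemma locally_integral_sum p (s : seq rat) (P : pred rat) :
  (forall x, x \in s -> P x -> locally_integral p x) ->
  locally_integral p (\sum_(x <- s | P x) x).
Proof.
move=> sp; rewrite big_seq_cond; apply: (big_ind (locally_integral p)).
- exact/locally_integral_int/rpred0.
- by move=> x y; apply: locally_integralD.
- by move=> x /andP[]; apply: sp.
Qed.

(** * The generators and their denominators *)

Definition gap (d m : nat) : nat := (m.+1 * d)%N.

(** The least common multiple of the two numerators: the first numerator reached both by long
    generators alone and by short ones alone. *)
Definition crossing (d m : nat) : nat := ((gap d m).+1 * (gap d m).*2.+1)%N.

(** The product of [d] and all [den d k] with [k < m]; [den] is inlined because it is itself built
    from this product. *)
Fixpoint den_prod (d m : nat) : nat :=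
  if m is k.+1 then (den_prod d k * (crossing d k * den_prod d k).+1)%N else d.

(** As in Euclid's proof of the infinitude of primes, adding 1 makes this coprime to [d] and to all
    earlier denominators; the factor [crossing d m] makes it large. *)
Definition den (d m : nat) : nat := (crossing d m * den_prod d m).+1.

Definition short_gen (d m : nat) : rat := (gap d m).+1%:R / (den d m)%:R.
Definition long_gen (d m : nat) : rat := (gap d m).*2.+1%:R / (den d m)%:R.

Definition gens (d : nat) : set rat :=
  [set x | exists m, x = short_gen d m \/ x = long_gen d m].

Definition gap_monoid (d : nat) : set rat := smallest is_submonoid (gens d).

Lemma den_prod_dvd d i j : (i <= j)%N -> (den_prod d i %| den_prod d j)%N.
Proof.
elim: j => [|j IHj]; first by rewrite leqn0 => /eqP->.
rewrite leq_eqVlt ltnS => /predU1P[-> //|/IHj ij] /=.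
exact: dvdn_mulr.
Qed.

Lemma coprime_den d i j : i != j -> coprime (den d i) (den d j).
Proof.
wlog ij : i j / (i < j)%N => [wl|_].
  move=> nij; have := nij; rewrite neq_ltn => /orP[] lt; first exact: wl.
  by rewrite coprime_sym wl // eq_sym.
have : (den d i %| crossing d j * den_prod d j)%N.
  by apply/dvdn_mull; apply: dvdn_trans (den_prod_dvd d ij); apply: dvdn_mull.
by move=> /coprime_dvdl; apply; apply: coprimenS.
Qed.

Lemma den_mod d m : (d %| (den d m).-1)%N.
Proof. exact/dvdn_mull/(@den_prod_dvd d 0 m). Qed.

Lemma coprime_den_d d m : coprime (den d m) d.
Proof.
by rewrite coprime_sym; apply: (coprime_dvdl (den_mod d m)); apply: coprimenS.
Qed.

Lemma den_natr_gt0 d m : 0 < (den d m)%:R :> rat.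
Proof. by rewrite ltr0n. Qed.

Lemma crossing_lt_den d m : (0 < d)%N -> (crossing d m < den d m)%N.
Proof.
move=> d0; rewrite ltnS leq_pmulr //.
by elim: m => [|m IHm] //=; rewrite muln_gt0 IHm.
Qed.

Lemma gens_gt0 d x : gens d x -> 0 < x.
Proof. by move=> [m [] ->]; rewrite divr_gt0 ?ltr0n. Qed.

Lemma gens_local_other d j x :
  gens d x -> x \notin [:: short_gen d j; long_gen d j] ->
  locally_integral (den d j) x.
Proof.
move=> [i xE] xj; have ij : i != j.
  by apply: contraNneq xj => <-; rewrite !inE; case: xE => ->; rewrite eqxx ?orbT.
by case: xE => ->; apply: locally_integral_div; rewrite // coprime_den.
Qed.

(** * Lengths modulo [d] *)

Lemma gens_cong1 d x :
  (0 < d)%N -> gens d x -> locally_integral d ((x - 1) / d%:R).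
Proof.
move=> d0 [m xE]; exists (den d m); first exact: coprime_den_d.
have [k kE] := dvdnP (den_mod d m); have {}kE : den d m = (k * d).+1 by rewrite -kE.
have dn0 : d%:R != 0 :> rat by rewrite pnatr_eq0 -lt0n.
have pn0 : (den d m)%:R != 0 :> rat by rewrite pnatr_eq0.
(* Numerator and denominator are both 1 modulo [d], so their difference is [(n - k) * d] and [d]
   cancels. *)
have key n : (den d m)%:R * (((n * d).+1%:R / (den d m)%:R - 1) / d%:R)
             = n%:R - k%:R :> rat.
  rewrite mulrA mulrBr mulr1 mulrC [_ * (_ / _)]mulrC divfK // kE -!natr1 !natrM.
  by field.
case: xE => ->.
  by rewrite /short_gen key rpredB ?rpred_nat.
by rewrite /long_gen /gap -muln2 mulnAC key rpredB ?rpred_nat.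
Qed.

(** Each summand contributes 1 modulo [d], so the value of the sum determines its length modulo
    [d]. *)
Lemma sum_cong_size d (s : seq rat) :
  (0 < d)%N -> (forall x, x \in s -> gens d x) ->
  locally_integral d ((\sum_(x <- s) x - (size s)%:R) / d%:R).
Proof.
move=> d0; elim: s => [|x s IHs] sG.
  by rewrite big_nil subrr mul0r; apply/locally_integral_int/rpred0.
rewrite big_cons /= -natr1.
have -> : x + \sum_(y <- s) y - ((size s)%:R + 1)
          = (x - 1) + (\sum_(y <- s) y - (size s)%:R) by ring.
rewrite mulrDl; apply: locally_integralD; first exact/gens_cong1/sG/mem_head.
by apply: IHs => y ys; apply: sG; rewrite inE ys orbT.
Qed.

(** * Sums too small to mix denominators *)

Lemma sum_two_gens d m (s : seq rat) :
  (forall x, x \in s -> x = short_gen d m \/ x = long_gen d m) ->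
  exists k l, size s = (k + l)%N /\
    \sum_(x <- s) x
      = (k * (gap d m).+1 + l * (gap d m).*2.+1)%:R / (den d m)%:R.
Proof.
elim: s => [|x s IHs] sG; first by exists 0, 0; rewrite big_nil mul0r.
have [|k [l [szE sumE]]] := IHs.
  by move=> y ys; apply: sG; rewrite inE ys orbT.
case: (sG x (mem_head _ _)) => ->; [exists k.+1, l | exists k, l.+1];
  (split; first by rewrite /= szE ?addnS);
  rewrite big_cons sumE -mulrDl -natrD mulSn; congr (_%:R / _).
- exact: addnA.
- exact: addnCA.
Qed.

Lemma small_sum_gens d m c (s : seq rat) :
  (c < den d m)%N -> (forall x, x \in s -> gens d x) ->
  \sum_(x <- s) x = c%:R / (den d m)%:R ->
  forall x, x \in s -> x = short_gen d m \/ x = long_gen d m.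
Proof.
move=> cp sG sumE x xs; have [j xE] := sG x xs.
have [<- //|jm] := eqVneq j m; exfalso.
(* Isolate the summands of the foreign denominator [den d j]; together they make [N / den d j]. *)
pose P (y : rat) := y \in [:: short_gen d j; long_gen d j].
have Px : P x by rewrite /P !inE; case: xE => ->; rewrite eqxx ?orbT.
have ge0 (A : pred rat) : 0 <= \sum_(y <- s | A y) y.
  by rewrite big_seq_cond sumr_ge0 // => y /andP[/sG/gens_gt0/ltW].
move: sumE; rewrite (bigID P) /= => sumE.
have [|k [l [_ partE]]] := @sum_two_gens d j (filter P s).
  by move=> y; rewrite mem_filter /P !inE => /andP[/orP[]/eqP->]; [left|right].
rewrite big_filter in partE.
set N := (X in X%:R / _) in partE.
have NE : N%:R / (den d j)%:R
          = c%:R / (den d m)%:R - \sum_(y <- s | ~~ P y) y :> rat.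
  by rewrite -partE -sumE addrK.
(* Everything else in the equation is integral at [den d j], so this part is an integer. Being
   positive, it is at least 1, while the whole sum is below 1. *)
have jN : (den d j %| N)%N.
  apply: locally_integral_dvd => //; rewrite NE; apply: locally_integralB.
    by apply: locally_integral_div; rewrite // coprime_den // eq_sym.
  by apply: locally_integral_sum => y ys; apply: gens_local_other; apply: sG.
have N0 : (0 < N)%N.
  have : 0 < N%:R / (den d j)%:R :> rat.
    rewrite -partE (big_rem x) //= Px ltr_pwDl ?(gens_gt0 (sG x xs)) //.
    by rewrite big_seq_cond sumr_ge0 // => y /andP[/mem_rem/sG/gens_gt0/ltW].
  by rewrite pmulr_lgt0 ?invr_gt0 ?den_natr_gt0 // ltr0n.
have : 1 <= N%:R / (den d j)%:R :> rat.
  by rewrite ler_pdivlMr ?den_natr_gt0 // mul1r ler_nat dvdn_leq.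
have : c%:R / (den d m)%:R < 1 :> rat.
  by rewrite ltr_pdivrMr ?den_natr_gt0 // mul1r ltr_nat.
have := ge0 (fun y => ~~ P y).
by move: NE; lra.
Qed.

Lemma small_sum_counts d m c (s : seq rat) :
  (c < den d m)%N -> (forall x, x \in s -> gens d x) ->
  \sum_(x <- s) x = c%:R / (den d m)%:R ->
  exists k l, size s = (k + l)%N /\
    (k * (gap d m).+1 + l * (gap d m).*2.+1)%N = c.
Proof.
move=> cp sG sumE.
have [k [l [szE]]] := sum_two_gens (small_sum_gens cp sG sumE).
rewrite sumE => /(divIf (lt0r_neq0 (den_natr_gt0 d m)))/eqP.
by rewrite eqr_nat => /eqP->; exists k, l.
Qed.

(** * The monoid, its atoms and its lengths *)

Lemma gap_monoid_submonoid d : is_submonoid (gap_monoid d).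
Proof.
split=> [N [[N0 _] _] //|x y Mx My N NM].
by case: (NM) => [[_ ND] _]; apply: ND; [apply: Mx | apply: My].
Qed.

Lemma gap_monoid_gens d x : gens d x -> gap_monoid d x.
Proof. by move=> Gx N [_]; apply. Qed.

Lemma gap_monoid_sum d (s : seq rat) :
  (forall x, x \in s -> gens d x) -> gap_monoid d (\sum_(x <- s) x).
Proof.
have [M0 MD] := gap_monoid_submonoid d.
move=> sG; rewrite big_seq; apply: (big_ind (gap_monoid d)) => // x xs.
exact: gap_monoid_gens (sG _ xs).
Qed.

Lemma gap_monoidP d x : gap_monoid d x ->
  exists2 s : seq rat, (forall y, y \in s -> gens d y) & x = \sum_(y <- s) y.
Proof.
pose sums (y : rat) := exists2 s : seq rat,
  (forall z, z \in s -> gens d z) & y = \sum_(z <- s) z.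
move=> /(_ sums); apply; split; last first.
  by move=> y Gy; exists [:: y]; rewrite ?big_seq1 // => z; rewrite inE => /eqP->.
split; first by exists [::]; rewrite ?big_nil.
move=> y z [s sG ->] [t tG ->]; exists (s ++ t); last by rewrite big_cat.
by move=> w; rewrite mem_cat => /orP[/sG|/tG].
Qed.

(** The first bound keeps the numerator below that of any two generators together, the second keeps
    it below [den d m]. *)
Lemma gen_numerator d m x : x = short_gen d m \/ x = long_gen d m ->
  exists c : nat, [/\ x = c%:R / (den d m)%:R, (c <= (gap d m).*2.+1)%N &
                      (c <= crossing d m)%N].
Proof.
case=> ->; [exists (gap d m).+1 | exists (gap d m).*2.+1]; split=> //.
- lia.
- exact: leq_pmulr.
- exact: leq_pmull.
Qed.

Lemma atoms_gap_monoid d : (0 < d)%N -> atoms (gap_monoid d) = gens d.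
Proof.
move=> d0; apply/seteqP; split=> x /=.
  move=> [/gap_monoidP[[|y s] sG ->] xn0 irr]; first by rewrite big_nil in xn0.
  have yG : gens d y by apply/sG/mem_head.
  rewrite big_cons in irr *.
  (* Splitting off the head is a forbidden decomposition unless the tail sums to 0. *)
  have [->|/eqP sn0] := eqVneq (\sum_(z <- s) z) 0; first by rewrite addr0.
  case: irr; exists y, (\sum_(z <- s) z); split=> //.
  - exact: gap_monoid_gens.
  - by apply: gap_monoid_sum => z zs; apply: sG; rewrite inE zs orbT.
  - by apply/eqP; rewrite gt_eqF // (gens_gt0 yG).
move=> xG; split; first exact: gap_monoid_gens.
  by apply/eqP; rewrite gt_eqF // (gens_gt0 xG).
case=> y [z [/gap_monoidP[s sG ->] /gap_monoidP[t tG ->] yn0 zn0 xE]].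
have [m xm] := xG; have [c [cE c_le c_cross]] := gen_numerator xm.
have [|||k [l [szE klE]]] := @small_sum_counts d m c (s ++ t).
- exact: leq_ltn_trans c_cross (crossing_lt_den m d0).
- by move=> w; rewrite mem_cat => /orP[/sG|/tG].
- by rewrite big_cat /= -xE cE.
have s0 : (0 < size s)%N by case: (s) yn0 => //; rewrite big_nil.
have t0 : (0 < size t)%N by case: (t) zn0 => //; rewrite big_nil.
rewrite size_cat in szE.
(* Here [k + l] is at least 2, so the numerator is at least [2 * (e + 1)], exceeding [2 * e + 1]. *)
move: (gap d m) klE c_le => e klE c_le; nia.
Qed.

Lemma lengths_gap_monoid d x n : (0 < d)%N ->
  lengths (gap_monoid d) x n <->
  exists s : seq rat,
    [/\ forall y, y \in s -> gens d y, \sum_(y <- s) y = x & size s = n].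
Proof.
move=> d0; rewrite /lengths /factorizations atoms_gap_monoid //; split.
  by move=> [z [zG sumE] szE]; exists z.
move=> [s [sG sumE szE]].
have zs : perm_eq (seq_mset s) s by apply: perm_eq_seq_mset.
exists (seq_mset s); last by rewrite -szE; apply: perm_size.
split=> [y ys|]; last by rewrite -sumE; apply: perm_big.
by apply: sG; rewrite -(perm_mem zs).
Qed.

Lemma lengths_crossing d m : (0 < d)%N ->
  lengths (gap_monoid d) ((crossing d m)%:R / (den d m)%:R)
    = [set (gap d m).+1; ((gap d m).+1 + gap d m)%N].
Proof.
move=> d0; apply/seteqP; split=> n /=; rewrite lengths_gap_monoid //.
  move=> [s [sG sumE <-]].
  have [k [l [-> klE]]] :=
    small_sum_counts (crossing_lt_den m d0) sG sumE.
  move: klE; rewrite /crossing; move: (gap d m) => e klE.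
  (* Reduce the equation modulo [e + 1], which is coprime to [2 * e + 1]. *)
  have /dvdnP[i lE] : (e.+1 %| l)%N.
    have : (e.+1 %| k * e.+1 + l * e.*2.+1)%N by rewrite klE dvdn_mulr.
    rewrite dvdn_addr; last exact: dvdn_mull.
    rewrite Gauss_dvdl // -addnn -addSn /coprime gcdnDl.
    exact: coprimeSn.
  (* [i = 0] leaves only short generators, [i = 1] only long ones, and a larger [i] overshoots. *)
  subst l; case: i klE => [|[|i]] klE; [right|left|]; nia.
case=> ->.
  exists (nseq (gap d m).+1 (long_gen d m)); rewrite size_nseq; split=> //.
    by move=> y /nseqP[-> _]; exists m; right.
  by rewrite big_nseq iter_addr_0 -[LHS]mulr_natl /long_gen mulrA -natrM.
exists (nseq (gap d m).*2.+1 (short_gen d m)); rewrite size_nseq; split.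
- by move=> y /nseqP[-> _]; exists m; left.
- by rewrite big_nseq iter_addr_0 -[LHS]mulr_natl /short_gen mulrA -natrM mulnC.
- lia.
Qed.

(** * The set of distances *)

Unset Implicit Arguments.

Theorem proposition4p12 (d : nat) (hd : (0 < d)%N) :
  exists M : set rat,
    [/\ puiseux_monoid M, atomic M &
        set_of_distances M = [set (m * d)%N | m in [set m : nat | (0 < m)%N]]].
Proof.
exists (gap_monoid d); split.
- split; first exact: gap_monoid_submonoid.
  move=> x /gap_monoidP[s sG ->] /=.
  by rewrite big_seq sumr_ge0 // => y /sG/gens_gt0/ltW.
- by rewrite /atomic atoms_gap_monoid.
apply/seteqP; split=> [delta [x _ [delta0 [l lx deltaE]]]|_ [[//|m] _ <-]].
  have /lengths_gap_monoid [//|s [sG sumE szE]] := lx.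
  have [ldx _] : (lengths (gap_monoid d) x `&`
      [set n | (l <= n <= l + delta)%N]) (l + delta)%N by rewrite deltaE; right.
  have /lengths_gap_monoid [//|t [tG tsumE tszE]] := ldx.
  (* Subtracting the congruences for two factorizations of [x], of lengths [l] and [l + delta],
     eliminates [x]. *)
  have /(locally_integral_dvd hd)/dvdnP[m mE] :
      locally_integral d (delta%:R / d%:R).
    have := locally_integralB (sum_cong_size hd sG) (sum_cong_size hd tG).
    rewrite sumE tsumE szE tszE natrD -mulrBl.
    by congr (locally_integral _ (_ / _)); ring.
  exists m => //=; rewrite lt0n; apply/eqP => m0.
  by rewrite mE m0 in delta0.
(* The multiple is now [m.+1 * d], which is [gap d m]. Having a length shows that this element lies
   in the monoid. *)
exists ((crossing d m)%:R / (den d m)%:R).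
  split; last first.
    by apply/eqP; rewrite gt_eqF // divr_gt0 ?ltr0n.
  have : lengths (gap_monoid d) ((crossing d m)%:R / (den d m)%:R) (gap d m).+1.
    by rewrite lengths_crossing //; left.
  by move=> /lengths_gap_monoid [//|s [sG <- _]]; apply: gap_monoid_sum.
split; first by rewrite muln_gt0.
rewrite -/(gap d m) lengths_crossing //; exists (gap d m).+1; first by left.
(* Both lengths lie in the interval, so intersecting with it changes nothing. *)
apply/setIidl => n [] -> /=; lia.
Qed.
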